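(* The manifolds $\mathbb OP^2$, $\mathbb O'P^2$ and $\mathbb OH^2$ (with the metrics described below) are special Osserman manifolds.
   Context: Octonions $\mathbb O=\mathbb H\oplus\mathbb H$ with product $(q_1,q_2)(p_1,p_2)=(q_1p_1-\bar p_2q_2,\ p_2q_1+q_2\bar p_1)$; para-octonions $\mathbb O'=\mathbb H\oplus\mathbb H$ with product $(q_1,q_2)(p_1,p_2)=(q_1p_1+\bar p_2q_2,\ p_2q_1+q_2\bar p_1)$; in both, conjugation $\overline{(q_1,q_2)}=(\bar q_1,-q_2)$, $\langle a,b\rangle=\mathrm{Re}(a\bar b)$, $|a|^2=\langle a,a\rangle$. For $\mathbb K\in\{\mathbb O,\mathbb O'\}$, let $\mathbb K^\times_+$ be the nonzero elements for $\mathbb O$ and $\{x:|x|^2>0\}$ for $\mathbb O'$; $\mathbb KP^2=\mathcal U/_\sim$ with $\mathcal U=\{(1,y,z):1+|y|^2+|z|^2>0\}\cup\{(x,1,z):|x|^2+1+|z|^2>0\}\cup\{(x,y,1):|x|^2+|y|^2+1>0\}\subset\mathbb K^3$ and $[a,b,c]\sim[d,e,f]$ iff $(a,b,c)=(d\lambda,e\lambda,f\lambda)$ with $\lambda\in\mathbb K^\times_+$; charts $[1,u,v]\mapsto(u,v)$, $[u,1,v]\mapsto(u,v)$, $[u,v,1]\mapsto(u,v)$, and metric on each chart, for tangent vector $(du,dv)=(\xi,\eta)$: $ds^2=\frac{|\xi|^2(1+|v|^2)+|\eta|^2(1+|u|^2)-2\mathrm{Re}[(u\bar v)(\eta\bar\xi)]}{(1+|u|^2+|v|^2)^2}$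 (Riemannian for $\mathbb O$, signature $(8,8)$ for $\mathbb O'$). $\mathbb OH^2=\{(u,v)\in\mathbb O^2:|u|^2+|v|^2<1\}$ with metric $ds^2=\frac{|\xi|^2(1-|v|^2)+|\eta|^2(1-|u|^2)+2\mathrm{Re}[(u\bar v)(\eta\bar\xi)]}{(1-|u|^2-|v|^2)^2}$. For a semi-Riemannian manifold with curvature $(1,3)$-tensor $R$ (convention: $g(R(X,Y)Z,W)=R(X,Y,Z,W)$ where in coordinates with vanishing first metric derivatives $R_{\alpha\beta\gamma\delta}=\tfrac12[\partial_\alpha\partial_\delta g_{\beta\gamma}+\partial_\beta\partial_\gamma g_{\alpha\delta}-\partial_\beta\partial_\delta g_{\alpha\gamma}-\partial_\alpha\partial_\gamma g_{\beta\delta}]$), the Jacobi operator at $P$ is $\mathcal J_v(x)=R(v,x)v$ for $v,x\in T_PM$. For unit $v$ (i.e. $\varepsilon_v:=g(v,v)=\pm1$) the manifold is special Osserman if there are real numbers $\lambda\neq\mu$, both nonzero, such that at every point and for every unit $v$: (I) $\mathcal J_v$ restricted to $v^\perp$ is diagonalizable with exactly the two nonzero eigenvalues $\varepsilon_v\lambda$ and $\varepsilon_v\mu$; (II) with $E_\lambda(v):=\mathrm{span}\{v\}\oplus\ker(\mathcal J_v-\varepsilon_v\lambda\,\mathrm{Id})$, if $w$ is a unit vector in $E_\lambda(v)$ then $E_\lambda(v)=E_\lambda(w)$; (III) if $w$ is unit and $w\in\ker(\mathcal J_v-\varepsilon_v\mu\,\mathrm{Id})$ then $v\in\ker(\mathcal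 J_w-\varepsilon_w\mu\,\mathrm{Id})$. *)

(* Defs.v *)
From HB Require Import structures.
From mathcomp Require Import all_boot all_order all_algebra.
From mathcomp Require Import all_classical all_reals all_analysis.
Set Implicit Arguments. Unset Strict Implicit. Unset Printing Implicit Defensive.
Import Order.TTheory GRing.Theory Num.Theory.
Import numFieldNormedType.Exports.
Local Open Scope ring_scope.

Record quat (R : realType) := Quat { qa : R; qb : R; qc : R; qd : R }.

Definition qadd {R : realType} (x y : quat R) : quat R :=
  Quat (qa x + qa y) (qb x + qb y) (qc x + qc y) (qd x + qd y).
Definition qopp {R : realType} (x : quat R) : quat R :=
  Quat (- qa x) (- qb x) (- qc x) (- qd x).
Definition qscale {R : realType} (s : R) (x : quat R) : quat R :=
  Quat (s * qa x) (s * qb x) (s * qc x) (s * qd x).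
Definition qconj {R : realType} (x : quat R) : quat R :=
  Quat (qa x) (- qb x) (- qc x) (- qd x).
Definition qmul {R : realType} (x y : quat R) : quat R :=
  Quat (qa x * qa y - qb x * qb y - qc x * qc y - qd x * qd y)
       (qa x * qb y + qb x * qa y + qc x * qd y - qd x * qc y)
       (qa x * qc y - qb x * qd y + qc x * qa y + qd x * qb y)
       (qa x * qd y + qb x * qc y - qc x * qb y + qd x * qa y).

(* s = -1 : octonions O ;  s = +1 : para-octonions O'.                   *)
Definition kel (R : realType) := (quat R * quat R)%type.

Definition sO {R : realType} : R := -1.
Definition sO' {R : realType} : R := 1.

Definition kmul {R : realType} (s : R) (x y : kel R) : kel R :=
  (qadd (qmul x.1 y.1) (qscale s (qmul (qconj y.2) x.2)),
   qadd (qmul y.2 x.1) (qmul x.2 (qconj y.1))).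
Definition kconj {R : realType} (x : kel R) : kel R := (qconj x.1, qopp x.2).
Definition kre {R : realType} (x : kel R) : R := qa x.1.
Definition knorm2 {R : realType} (s : R) (x : kel R) : R := kre (kmul s x (kconj x)).

(* Chart coordinates: a point (u,v) in K^2 is a row vector of R^16,     *)
(* u = coordinates 0..7, v = coordinates 8..15 (same for tangent        *)
(* vectors (xi, eta)).                                                  *)
Definition rc {R : realType} (p : 'rV[R]_16) (k : nat) : R := p 0 (@inord 15 k).
Definition kel_at {R : realType} (p : 'rV[R]_16) (o : nat) : kel R :=
  (Quat (rc p o) (rc p (o + 1)) (rc p (o + 2)) (rc p (o + 3)),
   Quat (rc p (o + 4)) (rc p (o + 5)) (rc p (o + 6)) (rc p (o + 7))).
Definition cu {R : realType} (p : 'rV[R]_16) : kel R := kel_at p 0.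
Definition cv {R : realType} (p : 'rV[R]_16) : kel R := kel_at p 8.

(* ds^2 of KP^2 (K = O for s = sO, K = O' for s = sO') on each of the
   three charts, as a quadratic form in the tangent vector X = (xi,eta)
   at the point p = (u,v). *)
Definition KP2_ds2 {R : realType} (s : R) (p X : 'rV[R]_16) : R :=
  let u := cu p in let v := cv p in let xi := cu X in let eta := cv X in
  (knorm2 s xi * (1 + knorm2 s v) + knorm2 s eta * (1 + knorm2 s u)
   - 2 * kre (kmul s (kmul s u (kconj v)) (kmul s eta (kconj xi))))
  / (1 + knorm2 s u + knorm2 s v) ^+ 2.

(* Image of each chart: {(u,v) : 1 + |u|^2 + |v|^2 > 0} (the condition
   defining U; for O it holds everywhere). *)
Definition KP2_chart {R : realType} (s : R) (p : 'rV[R]_16) : Prop :=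
  0 < 1 + knorm2 s (cu p) + knorm2 s (cv p).

Definition OH2_ds2 {R : realType} (p X : 'rV[R]_16) : R :=
  let s := @sO R in
  let u := cu p in let v := cv p in let xi := cu X in let eta := cv X in
  (knorm2 s xi * (1 - knorm2 s v) + knorm2 s eta * (1 - knorm2 s u)
   + 2 * kre (kmul s (kmul s u (kconj v)) (kmul s eta (kconj xi))))
  / (1 - knorm2 s u - knorm2 s v) ^+ 2.

Definition OH2_dom {R : realType} (p : 'rV[R]_16) : Prop :=
  knorm2 sO (cu p) + knorm2 sO (cv p) < 1.

(* Semi-Riemannian geometry in a coordinate chart of R^n, the metric   *)
(* being given by ds2 p X (a quadratic form in X for each point p).     *)
Definition ev {R : realType} {n : nat} (i : 'I_n) : 'rV[R]_n := delta_mx 0 i.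

(* metric coefficients g_ij(p) (polarisation of ds^2) *)
Definition gmat {R : realType} {n : nat} (ds2 : 'rV[R]_n -> 'rV[R]_n -> R)
  (p : 'rV[R]_n) : 'M[R]_n :=
  \matrix_(i, j) ((ds2 p (ev i + ev j) - ds2 p (ev i - ev j)) / 4).

Definition gbil {R : realType} {n : nat} (ds2 : 'rV[R]_n -> 'rV[R]_n -> R)
  (p X Y : 'rV[R]_n) : R := (X *m gmat ds2 p *m Y^T) 0 0.

Definition partial {R : realType} {n : nat} (f : 'rV[R]_n -> R)
  (p : 'rV[R]_n) (k : 'I_n) : R :=
  derive1 (fun t : R => f (p + t *: ev k)) 0.

Definition dg {R : realType} {n : nat} (ds2 : 'rV[R]_n -> 'rV[R]_n -> R)
  (p : 'rV[R]_n) (k i j : 'I_n) : R := partial (fun q => gmat ds2 q i j) p k.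

(* Christoffel symbols of the first kind
   Gam1 k i j = g(nabla_{d_i} d_j, d_k) = (d_i g_jk + d_j g_ik - d_k g_ij)/2 *)
Definition Gam1 {R : realType} {n : nat} (ds2 : 'rV[R]_n -> 'rV[R]_n -> R)
  (p : 'rV[R]_n) (k i j : 'I_n) : R :=
  (dg ds2 p i j k + dg ds2 p j i k - dg ds2 p k i j) / 2.

(* Covariant curvature tensor R_{abcd} = R(d_a,d_b,d_c,d_d), with the
   paper's sign convention (in coordinates with vanishing first metric
   derivatives it reduces to
   1/2 [d_a d_d g_bc + d_b d_c g_ad - d_b d_d g_ac - d_a d_c g_bd]). *)
Definition Rcov {R : realType} {n : nat} (ds2 : 'rV[R]_n -> 'rV[R]_n -> R)
  (p : 'rV[R]_n) (a b c d : 'I_n) : R :=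
  partial (fun q => Gam1 ds2 q d a c) p b - partial (fun q => Gam1 ds2 q d b c) p a
  + \sum_(r < n) \sum_(t < n) invmx (gmat ds2 p) r t *
      (Gam1 ds2 p r b c * Gam1 ds2 p t a d - Gam1 ds2 p r a c * Gam1 ds2 p t b d).

(* The (1,3) curvature tensor: R(X,Y)Z, defined by g(R(X,Y)Z,W) = R(X,Y,Z,W) *)
Definition curv {R : realType} {n : nat} (ds2 : 'rV[R]_n -> 'rV[R]_n -> R)
  (p X Y Z : 'rV[R]_n) : 'rV[R]_n :=
  \row_m \sum_(d < n) invmx (gmat ds2 p) m d *
     \sum_(a < n) \sum_(b < n) \sum_(c < n)
        X 0 a * Y 0 b * Z 0 c * Rcov ds2 p a b c d.

Definition jacobi {R : realType} {n : nat} (ds2 : 'rV[R]_n -> 'rV[R]_n -> R)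
  (p v x : 'rV[R]_n) : 'rV[R]_n := curv ds2 p v x v.

Definition unitv {R : realType} {n : nat} (ds2 : 'rV[R]_n -> 'rV[R]_n -> R)
  (p v : 'rV[R]_n) : Prop := gbil ds2 p v v = 1 \/ gbil ds2 p v v = -1.

Definition in_E {R : realType} {n : nat} (ds2 : 'rV[R]_n -> 'rV[R]_n -> R)
  (p : 'rV[R]_n) (lam : R) (v x : 'rV[R]_n) : Prop :=
  exists (c : R) (y : 'rV[R]_n),
    x = c *: v + y /\ jacobi ds2 p v y = (gbil ds2 p v v * lam) *: y.

Definition special_osserman_at {R : realType} {n : nat}
  (ds2 : 'rV[R]_n -> 'rV[R]_n -> R) (p : 'rV[R]_n) (lam mu : R) : Prop :=
  forall v : 'rV[R]_n, unitv ds2 p v ->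
  let eps := gbil ds2 p v v in
  [/\ (* (I) J_v on v^perp is diagonalizable with exactly the eigenvalues
         eps*lam and eps*mu: v^perp is the sum of the two eigenspaces,
         and both eigenvalues occur *)
      (forall x, gbil ds2 p v x = 0 ->
         exists y z : 'rV[R]_n,
           [/\ x = y + z, gbil ds2 p v y = 0, gbil ds2 p v z = 0,
               jacobi ds2 p v y = (eps * lam) *: y &
               jacobi ds2 p v z = (eps * mu) *: z]),
      (exists y : 'rV[R]_n, [/\ y != 0, gbil ds2 p v y = 0 &
               jacobi ds2 p v y = (eps * lam) *: y]),
      (exists z : 'rV[R]_n, [/\ z != 0, gbil ds2 p v z = 0 &
               jacobi ds2 p v z = (eps * mu) *: z]),
      (forall w, unitv ds2 p w -> in_E ds2 p lam v w ->
         forall x, in_E ds2 p lam v x <-> in_E ds2 p lam w x) &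
      (forall w, unitv ds2 p w ->
         jacobi ds2 p v w = (eps * mu) *: w ->
         jacobi ds2 p w v = (gbil ds2 p w w * mu) *: v)].

Definition special_osserman {R : realType} {n : nat}
  (D : 'rV[R]_n -> Prop) (ds2 : 'rV[R]_n -> 'rV[R]_n -> R) : Prop :=
  exists lam mu : R, [/\ lam != mu, lam != 0, mu != 0 &
    forall p, D p -> special_osserman_at ds2 p lam mu].

(* Main.v *)
Require Import Defs.
From HB Require Import structures.
From mathcomp Require Import all_boot all_order all_algebra.
From mathcomp Require Import all_classical all_reals all_analysis.
From mathcomp Require Import ring lra.
Set Implicit Arguments. Unset Strict Implicit. Unset Printing Implicit Defensive.
Import Order.TTheory GRing.Theory Num.Theory.
Import numFieldNormedType.Exports.
Local Open Scope ring_scope.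

(** On V = K^2 = R^16 let P(x,y)z = <x,y>z + A(x,y)z, where A(x,y) is the Clifford
    action of the trace-free part of the Hermitian 2x2 matrix x y^* + y x^* over K.
    The Clifford relations and the "rank one" identity P(x,x)x = 2<x,x>x are the
    only octonionic input. With tau = 1 for KP^2, tau = -1 for OH^2 and
    D = 1 + tau <p,p>, the metric at p is <Gx,y> with
    G = 1/D - tau P(p,p)/(2 D^2), the Christoffel symbols are -(tau/D) {x p y} for
    the Jordan triple product {x p y} = 2<p,x>y + 2<p,y>x - P(x,y)p, and the Jacobi
    operator is J_v x = tau ({x,Gv,v} - {v,Gx,v}). The square root B of G satisfies
    P(Bx,By) = B P(x,y) B, hence conjugates J at p to the Jacobi operator at the
    origin, J_v x = tau (<v,v>x - 4<v,x>v + (3/2) P(v,v)x). As P(v,v)/(2<v,v>) is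
    the projector on the K-line through v, the eigenvalues are 4 tau and tau. *)

(* The conditions of special_osserman_at for an arbitrary form g and Jacobi operator J. *)
Definition osserman (R : realType) (n : nat) (g : 'rV[R]_n -> 'rV[R]_n -> R)
    (J : 'rV[R]_n -> 'rV[R]_n -> 'rV[R]_n) (lam mu : R) : Prop :=
  forall v : 'rV[R]_n, g v v = 1 \/ g v v = -1 ->
  [/\ (forall x, g v x = 0 -> exists y z : 'rV[R]_n,
         [/\ x = y + z, g v y = 0, g v z = 0,
             J v y = (g v v * lam) *: y & J v z = (g v v * mu) *: z]),
      (exists y : 'rV[R]_n, [/\ y != 0, g v y = 0 & J v y = (g v v * lam) *: y]),
      (exists z : 'rV[R]_n, [/\ z != 0, g v z = 0 & J v z = (g v v * mu) *: z]),
      (forall w, g w w = 1 \/ g w w = -1 ->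
         (exists (k : R) (y : 'rV[R]_n),
            w = k *: v + y /\ J v y = (g v v * lam) *: y) ->
         forall x,
           (exists (k : R) (y : 'rV[R]_n),
              x = k *: v + y /\ J v y = (g v v * lam) *: y) <->
           (exists (k : R) (y : 'rV[R]_n),
              x = k *: w + y /\ J w y = (g w w * lam) *: y)) &
      (forall w, g w w = 1 \/ g w w = -1 -> J v w = (g v v * mu) *: w ->
         J w v = (g w w * mu) *: v)].

Lemma special_osserman_atE (R : realType) (n : nat)
    (ds2 : 'rV[R]_n -> 'rV[R]_n -> R) (p : 'rV[R]_n) (lam mu : R) :
  osserman (gbil ds2 p) (jacobi ds2 p) lam mu -> special_osserman_at ds2 p lam mu.
Proof. by []. Qed.

(** The five conditions involve only linear combinations, [g] and [J], so a linear bijection that is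
    isometric and intertwines the Jacobi operators pulls them back from [g0], [J0] to [g], [J]. *)
Lemma osserman_transport (R : realType) (n : nat) (B : 'rV[R]_n -> 'rV[R]_n)
    (g g0 : 'rV[R]_n -> 'rV[R]_n -> R)
    (J J0 : 'rV[R]_n -> 'rV[R]_n -> 'rV[R]_n) (lam mu : R) :
  {morph B : x y / x + y} -> (forall k, {morph B : x / k *: x}) ->
  injective B -> (forall x, exists y, B y = x) ->
  (forall x y, g x y = g0 (B x) (B y)) ->
  (forall v x, B (J v x) = J0 (B v) (B x)) ->
  osserman g0 J0 lam mu -> osserman g J lam mu.
Proof.
move=> BD BZ Binj Bsurj gE JE os v uv.
have B0 : B 0 = 0 by rewrite -(scale0r 0) BZ !scale0r.
have eigE w y k : J w y = (g w w * k) *: y <->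
    J0 (B w) (B y) = (g0 (B w) (B w) * k) *: B y.
  by rewrite -JE -gE -BZ; split=> [->|/Binj].
have lineE w x :
    (exists (k : R) (y : 'rV[R]_n), x = k *: w + y /\ J w y = (g w w * lam) *: y)
    <-> (exists (k : R) (y : 'rV[R]_n), B x = k *: B w + y /\
          J0 (B w) y = (g0 (B w) (B w) * lam) *: y).
  split=> [[k [y [-> /eigE e]]]|[k [y' []]]].
    by exists k, (B y); rewrite BD BZ.
  have [y <-] := Bsurj y'; rewrite -BZ -BD => /Binj-> /eigE e.
  by exists k, y.
have uv' : g0 (B v) (B v) = 1 \/ g0 (B v) (B v) = -1 by rewrite -gE.
have [h1 [y0 h2] [z0 h3] h4 h5] := os (B v) uv'; split.
- move=> x; rewrite gE => /h1 [y' [z' []]].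
  have [y <-] := Bsurj y'; have [z <-] := Bsurj z'.
  rewrite -BD -!gE => /Binj-> e1 e2 e3 e4; exists y, z; split=> //.
    by apply/eigE; rewrite -gE.
  by apply/eigE; rewrite -gE.
- move: h2; have [y <-] := Bsurj y0; rewrite -!gE => -[ne e1 e2].
  exists y; split=> //; last by apply/eigE; rewrite -gE.
  by apply: contraNneq ne => ->; rewrite B0.
- move: h3; have [y <-] := Bsurj z0; rewrite -!gE => -[ne e1 e2].
  exists y; split=> //; last by apply/eigE; rewrite -gE.
  by apply: contraNneq ne => ->; rewrite B0.
- move=> w uw /lineE hw x; rewrite gE in uw; have h := h4 _ uw hw (B x).
  exact: iff_trans (lineE v x) (iff_trans h (iff_sym (lineE w x))).
- by move=> w uw /eigE; rewrite gE in uw => /(h5 _ uw) h; apply/eigE.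
Qed.

(** * Rank one triples *)

(* The model is P x y = <x,y> + A(x,y) with A Clifford valued: P_cliff is the
   polarised relation A(x,x)^2 = |A(x,x)|^2 and P_cyc polarises P x x x = 2 <x,x> x. *)
Record rank_one_triple (R : realType) (n : nat) (ip : 'rV[R]_n -> 'rV[R]_n -> R)
    (P : 'rV[R]_n -> 'rV[R]_n -> 'rV[R]_n -> 'rV[R]_n) : Prop := RankOneTriple {
  ipC : forall x y, ip x y = ip y x;
  ipDl : forall x y z, ip (x + y) z = ip x z + ip y z;
  ipZl : forall a x z, ip (a *: x) z = a * ip x z;
  ip_nondeg : forall x, (forall y, ip x y = 0) -> x = 0;
  PC : forall x y z, P x y z = P y x z;
  PDl : forall x x' y z, P (x + x') y z = P x y z + P x' y z;
  PZl : forall a x y z, P (a *: x) y z = a *: P x y z;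
  PDr : forall x y z z', P x y (z + z') = P x y z + P x y z';
  PZr : forall a x y z, P x y (a *: z) = a *: P x y z;
  P_pair : forall x y z w, ip (P x y z) w = ip (P z w x) y;
  P_cyc : forall x y z, P x y z + P y z x + P z x y
    = 2 *: (ip x y *: z + ip y z *: x + ip z x *: y);
  P_cliff : forall x y z w t, P x y (P z w t) + P z w (P x y t)
    = (2 * ip z w) *: P x y t + (2 * ip x y) *: P z w t
      + (2 * ip (P x y z) w - 4 * ip x y * ip z w) *: t }.

Section RankOneTriple.
Variables (R : realType) (n : nat).
Local Notation V := 'rV[R]_n.
Variables (ip : V -> V -> R) (P : V -> V -> V -> V).
Hypothesis H : rank_one_triple ip P.
Implicit Types (x y z t u v w p : V) (a : R).

Let ipC := ipC H.
Let PC := PC H.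

Lemma ipDr x y z : ip z (x + y) = ip z x + ip z y.
Proof. by rewrite ipC (ipDl H) !(ipC _ z). Qed.
Lemma ipZr a x z : ip z (a *: x) = a * ip z x.
Proof. by rewrite ipC (ipZl H) ipC. Qed.
Lemma ipNl x z : ip (- x) z = - ip x z.
Proof. by rewrite -scaleN1r (ipZl H) mulN1r. Qed.
Lemma ipNr x z : ip z (- x) = - ip z x.
Proof. by rewrite ipC ipNl ipC. Qed.
Lemma ip0l z : ip 0 z = 0.
Proof. by rewrite -(scale0r z) (ipZl H) mul0r. Qed.

Lemma PDm x y y' z : P x (y + y') z = P x y z + P x y' z.
Proof. by rewrite PC (PDl H) !(PC _ x). Qed.
Lemma PZm a x y z : P x (a *: y) z = a *: P x y z.
Proof. by rewrite PC (PZl H) PC. Qed.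
Lemma PNl x y z : P (- x) y z = - P x y z.
Proof. by rewrite -scaleN1r (PZl H) scaleN1r. Qed.
Lemma PNm x y z : P x (- y) z = - P x y z.
Proof. by rewrite PC PNl PC. Qed.
Lemma PNr x y z : P x y (- z) = - P x y z.
Proof. by rewrite -scaleN1r (PZr H) scaleN1r. Qed.

Definition triE := (ipDl H, ipZl H, ipDr, ipZr, ipNl, ipNr, PDl H, PZl H,
  PDm, PZm, PDr H, PZr H, PNl, PNm, PNr).

Lemma ip_inj x y : (forall w, ip x w = ip y w) -> x = y.
Proof.
move=> e; apply/eqP; rewrite -subr_eq0; apply/eqP/(ip_nondeg H) => w.
by rewrite !triE e subrr.
Qed.

Lemma P_adj x y z w : ip (P x y z) w = ip z (P x y w).
Proof. by rewrite (P_pair H) (PC z w) -(P_pair H) ipC. Qed.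

(** * Algebraic identities of rank one triples *)

Lemma P_diag v : P v v v = (2 * ip v v) *: v.
Proof.
apply/rowP => i; move/(congr1 (fun y : V => y 0 i)): (P_cyc H v v v).
by rewrite !mxE; lra.
Qed.

Lemma P_slide x v : P x v v = ip v v *: x + (2 * ip x v) *: v - 2^-1 *: P v v x.
Proof.
apply/rowP => i; move/(congr1 (fun y : V => y 0 i)): (P_cyc H x v v).
by rewrite (PC v x v) (ipC v x) !mxE; lra.
Qed.

(** In the Clifford relation at four copies of [v] the scalar term vanishes by [P_diag]. So
    [P v v / (2 <v,v>)] is idempotent for non-null [v]. *)
Lemma P_sq v x : P v v (P v v x) = (2 * ip v v) *: P v v x.
Proof.
apply/rowP => i; move/(congr1 (fun y : V => y 0 i)): (P_cliff H v v v v x).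
by rewrite P_diag !triE !mxE; lra.
Qed.

(** The Clifford relation applied to [P v v x], where [P_sq] cancels all terms but one. Compressing
    any [P z w] by [P v v] thus leaves a multiple of [P v v]. *)
Lemma P_sandwich v z w x :
  P v v (P z w (P v v x)) = (2 * ip (P v v z) w) *: P v v x.
Proof.
apply/rowP => i; move/(congr1 (fun y : V => y 0 i)): (P_cliff H v v z w (P v v x)).
by rewrite !(P_sq, triE) !mxE; lra.
Qed.

(** This is [P_sandwich] read through the pair symmetry [P_pair]. *)
Lemma P_fundamental v x y z :
  P (P v v x) (P v v y) z = (2 * ip (P v v x) y) *: P v v z.
Proof.
apply: ip_inj => w.
rewrite (P_pair H) -(P_adj v v) P_sandwich !triE; ring.
Qed.

Lemma P_derivation u v x y z : P (P u v x) y z + P x (P u v y) z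
  = (2 * ip x y) *: P u v z + (2 * ip u v) *: P x y z
    + (2 * ip (P u v x) y - 4 * ip u v * ip x y) *: z.
Proof.
apply: ip_inj => w; move/(congr1 (ip^~ y)): (P_cliff H u v z w x).
rewrite !triE (P_pair H (P u v x)) (P_pair H x (P u v y)).
rewrite -(P_adj u v) (P_pair H x y z w) => e.
lra.
Qed.

(** [P_derivation] moves [P v y] off the inner [p], [P_slide] removes the terms [P _ p p], and the
    Clifford relation reorders [P p p] and [P v y]. *)
Lemma P_slide2 p x v y : P x (P v y p) p
  = (2 * ip x p) *: P v y p - 2^-1 *: P v y (P p p x) + ip (P p p v) y *: x.
Proof.
have e1 := P_derivation v y x p p; have e2 := P_slide (P v y x) p.
have e3 := P_slide x p; have e4 := P_cliff H p p v y x.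
move: e1; rewrite e2 e3 => e1.
apply/rowP => i; move/(congr1 (fun y : V => y 0 i)): e4.
move/(congr1 (fun y : V => y 0 i)): e1.
by rewrite !mxE; lra.
Qed.

(** * The Jordan triple product *)

Definition jtriple x p y := (2 * ip p x) *: y + (2 * ip p y) *: x - P x y p.

Lemma triC x p y : jtriple x p y = jtriple y p x.
Proof. by rewrite /jtriple PC (addrC (_ *: y)). Qed.

(** Evaluates the products of Christoffel symbols in the curvature; its last two terms become the
    [P p p] part of [gop] in the Jacobi operator. *)
Lemma tri_commutator x p v : jtriple x p (jtriple v p v) - jtriple v p (jtriple x p v)
  = (2 * ip p v) *: jtriple x p v - (2 * ip p x) *: jtriple v p v
    - 2^-1 *: jtriple v (P p p v) x + 2^-1 *: jtriple v (P p p x) v.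
Proof.
have e1 := P_slide2 p x v v; have e2 := P_slide2 p v x v.
rewrite /jtriple !triE e1 e2 !(PC v x) (ipC x p) (ipC v p) !(ipC p (P _ _ _)).
rewrite (P_pair H v v p) (P_pair H x v p) (P_adj p p v x) (ipC v).
by apply/rowP => i; rewrite !mxE; by field.
Qed.

(* Here s is the sign tau of the header: 1 for KP^2 and -1 for OH^2. *)
Section Metric.
Variables (s : R) (p : V).

Definition conf_factor := 1 + s * ip p p.
Hypothesis D0 : 0 < conf_factor.

Definition gop x := conf_factor^-1 *: x - (s / (2 * conf_factor ^+ 2)) *: P p p x.
Definition gop_inv x := conf_factor *: (x + (s / 2) *: P p p x).
(** The form [<Gx,y>], put over one denominator to match the shape of the given [ds^2]. *)
Definition gmetric x y := (ip x y * conf_factor - s / 2 * ip (P p p x) y) / conf_factor ^+ 2.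

Lemma gformE x y : gmetric x y = ip (gop x) y.
Proof.
rewrite /gmetric /gop !triE; field; by rewrite lt0r_neq0.
Qed.

Lemma ipppE : s * ip p p = conf_factor - 1.
Proof. by rewrite /conf_factor addrC addKr. Qed.

Lemma gopK x : gop_inv (gop x) = x.
Proof.
have c0 : conf_factor != 0 by rewrite lt0r_neq0.
rewrite /gop /gop_inv !triE P_sq; apply/rowP => i; rewrite !mxE.
(* This isolates the coefficient of [P p p x], which vanishes once [s * ip p p] is replaced by
   [conf_factor - 1]. *)
transitivity (x 0 i + P p p x 0 i
    * (s / 2 - s / (2 * conf_factor) - s / (2 * conf_factor) * (s * ip p p))).
  by field.
by rewrite ipppE; field.
Qed.

Lemma gop_invK x : gop (gop_inv x) = x.
Proof.
have c0 : conf_factor != 0 by rewrite lt0r_neq0.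
rewrite /gop /gop_inv !triE P_sq; apply/rowP => i; rewrite !mxE.
transitivity (x 0 i + P p p x 0 i
    * (s / 2 - s / (2 * conf_factor) - s / (2 * conf_factor) * (s * ip p p))).
  by field.
by rewrite ipppE; field.
Qed.

(* As P(p,p)^2 = 2 <p,p> P(p,p), squaring 1 + c P(p,p) to D G = 1 - s P(p,p)/(2D) means
   2c + 2 c^2 <p,p> = -s/(2D), which factors through s <p,p> = D - 1 = (r - 1)(r + 1). *)
Let r := Num.sqrt conf_factor.
Let c := - s / (2 * (r * (r + 1))).
Definition gsqrt x := r^-1 *: (x + c *: P p p x).

Let rE : conf_factor = r ^+ 2.
Proof. by rewrite /r sqr_sqrtr // ltW. Qed.
Let r0 : 0 < r. Proof. by rewrite sqrtr_gt0. Qed.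
Let rn0 : r != 0. Proof. by rewrite lt0r_neq0. Qed.
Let r1n0 : r + 1 != 0. Proof. by rewrite lt0r_neq0 // addr_gt0. Qed.

Lemma gsqrtE x : gsqrt (gsqrt x) = gop x.
Proof.
rewrite /gsqrt /gop !triE P_sq; apply/rowP => i; rewrite !mxE rE.
transitivity (r ^- 2 * (x 0 i + P p p x 0 i * (2 * c + c * (- (s * ip p p) / (r * (r+1)))))).
  by rewrite /c; field; rewrite rn0 r1n0.
by rewrite ipppE rE /c; field; rewrite rn0 r1n0.
Qed.

Lemma gsqrt_adj x y : ip (gsqrt x) y = ip x (gsqrt y).
Proof. by rewrite /gsqrt !triE P_adj. Qed.

Lemma gform_sqrt x y : gmetric x y = ip (gsqrt x) (gsqrt y).
Proof. by rewrite gformE -gsqrt_adj gsqrtE. Qed.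

Lemma gsqrt_inj : injective gsqrt.
Proof. by move=> x y e; rewrite -(gopK x) -(gopK y) -!gsqrtE e. Qed.

Lemma gsqrt_surj x : exists y, gsqrt y = x.
Proof. by exists (gsqrt (gop_inv x)); rewrite gsqrtE gop_invK. Qed.

(** Expand in powers of [c]: the terms in [c ^ 2] agree by [P_fundamental] and [P_sandwich], those
    in [c] because [P_derivation] and [P_cliff] have equal right-hand sides. *)
Lemma P_gsqrt x y z : P (gsqrt x) (gsqrt y) z = gsqrt (P x y (gsqrt z)).
Proof.
rewrite /gsqrt !triE P_fundamental P_sandwich.
have e := P_derivation p p x y z; have e' := P_cliff H p p x y z.
apply/rowP => i; move/(congr1 (fun y : V => y 0 i)): e.
move/(congr1 (fun y : V => y 0 i)): e'.
rewrite !mxE => e' e.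
apply/eqP; rewrite -subr_eq0; apply/eqP.
transitivity (r^-1 * r^-1 * c * ((P (P p p x) y z 0 i + P x (P p p y) z 0 i) -
    (P p p (P x y z) 0 i + P x y (P p p z) 0 i))); first by ring.
rewrite e e'; ring.
Qed.

Definition jac v x := s *: (jtriple x (gop v) v - jtriple v (gop x) v).

End Metric.

Definition jac0 s v x := s *: (ip v v *: x - (4 * ip v x) *: v + (3 / 2) *: P v v x).

(** Writing [gop] as the square of [gsqrt], [P_gsqrt] expresses every term through the images of [v]
    and [x]; [P_slide] then removes [P x' v' v']. *)
Lemma gsqrt_jac s p (D0 : 0 < conf_factor s p) v x :
  gsqrt s p (jac s p v x) = jac0 s (gsqrt s p v) (gsqrt s p x).
Proof.
have sqL y z : gsqrt s p (y + z) = gsqrt s p y + gsqrt s p z.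
  by rewrite /gsqrt !triE; apply/rowP => i; rewrite !mxE; ring.
have sqZ k y : gsqrt s p (k *: y) = k *: gsqrt s p y.
  by rewrite /gsqrt !triE; apply/rowP => i; rewrite !mxE; ring.
have sqN y : gsqrt s p (- y) = - gsqrt s p y by rewrite -scaleN1r sqZ scaleN1r.
have gE y z : ip (gop s p y) z = ip (gsqrt s p y) (gsqrt s p z).
  by rewrite -gsqrtE // gsqrt_adj.
rewrite /jac /jtriple /jac0 !(sqL, sqZ, sqN) !gE -!gsqrtE // -!P_gsqrt //.
move: (gsqrt s p v) (gsqrt s p x) => v' x'.
rewrite (P_slide x' v') (ipC x' v').
apply/rowP => i; rewrite !mxE; by field.
Qed.

(** * Eigenspaces of the Jacobi operator at the origin *)

Section Eigen.
Variables (s : R) (v : V).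
Hypothesis s2 : s * s = 1.
Hypothesis v2 : ip v v * ip v v = 1.

Let sn0 : s != 0.
Proof. by apply/eqP => e; move: s2; rewrite e mul0r => /esym/eqP; rewrite oner_eq0. Qed.
Let en0 : ip v v != 0.
Proof. by apply/eqP => e; move: v2; rewrite e mul0r => /esym/eqP; rewrite oner_eq0. Qed.

(** By [P_diag] the three terms contribute 1 - 4 + 3 = 0 times [s <v,v> <v,x>]. *)
Lemma jac0_orth x : ip v (jac0 s v x) = 0.
Proof.
rewrite /jac0 !triE (ipC v (P _ _ _)) P_adj P_diag !triE (ipC x v); by field.
Qed.

(** Conditions (II) and (III) speak of eigenvectors without asking for orthogonality to [v]; this
    supplies it. *)
Lemma jac0_eigen_orth k y : k != 0 -> jac0 s v y = k *: y -> ip v y = 0.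
Proof.
move=> k0 e; have := jac0_orth y; rewrite e !triE => /eqP.
by rewrite mulf_eq0 (negbTE k0) => /eqP.
Qed.

(** On the orthogonal complement of [v] the operator is [s (<v,v> + (3/2) P v v)], so the
    eigenvalues [2 <v,v>] and 0 of [P v v] yield the factors 1 + 3 and 1. *)
Lemma jac0_lamP y : jac0 s v y = (ip v v * (4 * s)) *: y
  <-> P v v y = (2 * ip v v) *: y /\ ip v y = 0.
Proof.
split=> [e|[e e0]].
  have e0 : ip v y = 0.
    apply: jac0_eigen_orth e; rewrite !mulf_neq0 //; lra.
  split=> //; have k0 : s * (3 / 2) != 0 by rewrite mulf_neq0 //; lra.
  apply: (scalerI k0).
  apply/rowP => i; move/(congr1 (fun y : V => y 0 i)): e.
  rewrite /jac0 e0 !mxE; lra.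
rewrite /jac0 e e0; apply/rowP => i; rewrite !mxE; by field.
Qed.

Lemma jac0_muP y : jac0 s v y = (ip v v * s) *: y
  <-> P v v y = 0 /\ ip v y = 0.
Proof.
split=> [e|[e e0]].
  have e0 : ip v y = 0 by apply: jac0_eigen_orth e; rewrite !mulf_neq0.
  split=> //; have k0 : s * (3 / 2) != 0 by rewrite mulf_neq0 //; lra.
  apply: (scalerI k0).
  apply/rowP => i; move/(congr1 (fun y : V => y 0 i)): e.
  rewrite /jac0 e0 !mxE; lra.
rewrite /jac0 e e0; apply/rowP => i; rewrite !mxE; by field.
Qed.

(* The span of v and the 4-eigenspace is the range of the projector P(v,v)/(2<v,v>). *)
Lemma jac0_lineP x :
  (exists (k : R) (y : V), x = k *: v + y /\ jac0 s v y = (ip v v * (4 * s)) *: y)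
  <-> P v v x = (2 * ip v v) *: x.
Proof.
split=> [[k [y [-> /jac0_lamP[e _]]]]|e].
  by rewrite !triE P_diag e; apply/rowP => i; rewrite !mxE; ring.
exists (ip v v * ip v x), (x - (ip v v * ip v x) *: v).
split; first by rewrite addrC subrK.
apply/jac0_lamP; rewrite !triE e P_diag; split.
  by apply/rowP => i; rewrite !mxE; ring.
by rewrite mulrAC v2 mul1r subrr.
Qed.

(** The Clifford relation makes [P v w w] an eigenvector of [P v v] for [2 <v,v>], while [P_slide]
    gives [P v w w = <w,w> v - P w w v / 2]. As [P v v] kills [P w w v], comparison leaves
    [<v,v> P w w v = 0]. *)
Lemma P_orth_sym w : ip w w * ip w w = 1 -> ip v w = 0 -> P v v w = 0 ->
  P w w v = 0.
Proof.
move=> w2 vw0 e.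
have e1 := P_cliff H v v v w w; have e2 := P_slide v w.
have e3 := P_cliff H v v w w v.
have e4 : P v v (P w w v) = 0.
  apply/rowP => i; move/(congr1 (fun y : V => y 0 i)): e3.
  rewrite P_diag e !triE ip0l !mxE; lra.
have e5 : P v w 0 = 0 by rewrite -(scale0r 0) (PZr H) !scale0r.
move: e1; rewrite e e2 !triE e e4 e5 P_diag vw0 !triE vw0 => e1.
apply: (scalerI en0); apply/rowP => i; move/(congr1 (fun y : V => y 0 i)): e1.
rewrite !mxE; lra.
Qed.

(** Here [w] is [P v v w / (2 <v,v>)], so [P_fundamental] makes [P w w] proportional to [P v v]:
    points of one K-line define the same projector. *)
Lemma P_line w : ip w w * ip w w = 1 -> P v v w = (2 * ip v v) *: w ->
  forall x, P w w x = (ip v v * ip w w) *: P v v x.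
Proof.
move=> w2 e x; have e1 := P_fundamental v w w x.
rewrite e !triE in e1.
have k0 : (2 * ip v v) * (2 * ip v v) != 0 by rewrite !mulf_neq0 //; lra.
apply: (scalerI k0); rewrite -[LHS]scalerA e1; apply/rowP => i; rewrite !mxE.
transitivity (4 * ip w w * ip v v * P v v x 0 i * (ip v v * ip v v)); last by ring.
by rewrite v2; ring.
Qed.
End Eigen.

(** The hypotheses say that the projector [P v v / (2 <v,v>)] is neither the identity, so [s]
    occurs, nor the real projector onto [v], so [4 * s] occurs. (II) follows from [P_line], (III)
    from [P_orth_sym]. *)
Lemma jac0_osserman s : s * s = 1 ->
  (forall v, ip v v != 0 -> exists x, P v v x != (2 * ip v v) *: x) ->
  (forall v, ip v v != 0 -> exists x, P v v x != (2 * ip v x) *: v) ->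
  osserman ip (jac0 s) (4 * s) s.
Proof.
move=> s2 N1 N2 v uv.
have sq1 w : ip w w = 1 \/ ip w w = -1 -> ip w w * ip w w = 1.
  by case=> ->; rewrite ?mulrNN mulr1.
have n0 w : ip w w = 1 \/ ip w w = -1 -> ip w w != 0.
  by case=> ->; rewrite ?oppr_eq0 oner_eq0.
have v2 := sq1 _ uv; have vn0 := n0 _ uv.
have adj x : ip v (P v v x) = 2 * ip v v * ip v x by rewrite -P_adj P_diag !triE.
split.
- move=> x vx0.
  (* The projector and its complement: [<v,v> / 2] equals [1 / (2 <v,v>)] since [<v,v>^2 = 1]. *)
  exists ((ip v v / 2) *: P v v x), (x - (ip v v / 2) *: P v v x).
  have e1 : ip v ((ip v v / 2) *: P v v x) = 0 by rewrite !triE adj vx0 !mulr0.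
  have e2 : ip v (x - (ip v v / 2) *: P v v x) = 0 by rewrite !triE adj vx0 !mulr0 subr0.
  split=> //; first by rewrite addrC subrK.
    apply/jac0_lamP => //; split=> //; rewrite !triE P_sq.
    by apply/rowP => i; rewrite !mxE; field.
  apply/jac0_muP => //; split=> //; rewrite !triE P_sq.
  apply/rowP => i; rewrite !mxE.
  transitivity (P v v x 0 i * (1 - ip v v * ip v v)); first by field.
  by rewrite v2 subrr mulr0.
- have [x nx] := N2 v vn0.
  (* Up to scale, the part of the projection of [x] orthogonal to [v]; it stays in the K-line of
     [v]. *)
  exists (P v v x - (2 * ip v x) *: v); rewrite subr_eq0; split=> //.
    by rewrite !triE adj; ring.
  apply/jac0_lamP => //; rewrite !triE P_sq P_diag adj; split; last by ring.
  by apply/rowP => i; rewrite !mxE; ring.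
- have [x nx] := N1 v vn0.
  exists (P v v x - (2 * ip v v) *: x); rewrite subr_eq0; split=> //.
    by rewrite !triE adj; ring.
  apply/jac0_muP => //; rewrite !triE P_sq adj subrr; split=> //; by ring.
- move=> w uw /jac0_lineP-/(_ s2 v2) e x.
  have w2 := sq1 _ uw.
  have k0 : ip v v * ip w w != 0 by rewrite mulf_neq0 // n0.
  split=> /jac0_lineP ex; apply/jac0_lineP => //.
    rewrite (P_line v2 w2 e) ex //; apply/rowP => i; rewrite !mxE.
    transitivity (2 * ip w w * x 0 i * (ip v v * ip v v)); first by ring.
    by rewrite v2 mulr1.
  apply: (scalerI k0); rewrite -(P_line v2 w2 e) ex //; apply/rowP => i; rewrite !mxE.
  transitivity (2 * ip w w * x 0 i * (ip v v * ip v v)); last by ring.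
  by rewrite v2 mulr1.
- move=> w uw /jac0_muP-/(_ s2 v2) [e e0]; have w2 := sq1 _ uw.
  by apply/jac0_muP => //; rewrite ipC (P_orth_sym v2 w2).
Qed.
End RankOneTriple.

(** * Curvature of the metric *)

Lemma row_linear_sum (R : realType) (n : nat) (W : lmodType R) (f : 'rV[R]_n -> W) :
  {morph f : x y / x + y} -> (forall k, {morph f : x / k *: x}) ->
  forall x, f x = \sum_i x 0 i *: f (ev i).
Proof.
move=> fD fZ x; have f0 : f 0 = 0 by rewrite -(scale0r 0) fZ !scale0r.
rewrite {1}(row_sum_delta x) (big_morph f fD f0).
by apply: eq_bigr => i _; rewrite fZ.
Qed.

(** Along a coordinate line every numerator and denominator below is a polynomial in [t] of degree
    at most three. *)
Lemma is_derive_cubic (R : realType) (a0 a1 a2 a3 : R) :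
  is_derive (0 : R) (1 : R) (fun t : R => a0 + a1 * t + a2 * t ^+ 2 + a3 * t ^+ 3) a1.
Proof.
apply: is_derive_eq.
by rewrite /GRing.scale /=; ring.
Qed.

(** With [D] the conformal factor, metric coefficients have the form [A / D^2] and lowered
    Christoffel symbols the form [A / D^2 + B / D^3]. *)
Lemma is_derive_quotients (R : realType) (A B D : R -> R) (a b d : R) :
  is_derive (0 : R) (1 : R) A a -> is_derive (0 : R) (1 : R) B b ->
  is_derive (0 : R) (1 : R) D d -> D 0 != 0 ->
  is_derive (0 : R) (1 : R) (fun t : R => A t / D t ^+ 2 + B t / D t ^+ 3)
    (a / D 0 ^+ 2 - 2 * A 0 * d / D 0 ^+ 3 + b / D 0 ^+ 3 - 3 * B 0 * d / D 0 ^+ 4).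
Proof.
move=> dA dB dD D0.
have dV2 : is_derive (0 : R) (1 : R) (fun t : R => (D t ^+ 2)^-1) (- 2 * d / D 0 ^+ 3).
  apply: is_derive_eq (@is_deriveV R (fun t => D t ^+ 2) 0 _ 1 _ (is_deriveX 2 dD)) _.
    by rewrite expf_neq0.
  by rewrite /GRing.scale /=; field.
have dV3 : is_derive (0 : R) (1 : R) (fun t : R => (D t ^+ 3)^-1) (- 3 * d / D 0 ^+ 4).
  apply: is_derive_eq (@is_deriveV R (fun t => D t ^+ 3) 0 _ 1 _ (is_deriveX 3 dD)) _.
    by rewrite expf_neq0.
  by rewrite /GRing.scale /=; field.
apply: is_derive_eq (is_deriveD (is_deriveM dA dV2) (is_deriveM dB dV3)) _.
by rewrite /GRing.scale /=; field.
Qed.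

Lemma partialE (R : realType) (n : nat) (f : 'rV[R]_n -> R) (p : 'rV[R]_n) (k : 'I_n) (l : R) :
  is_derive (0 : R) (1 : R) (fun t : R => f (p + t *: ev k)) l -> partial f p k = l.
Proof. by move=> h; rewrite /partial derive1E derive_val. Qed.

Section Curvature.
Variables (R : realType) (n : nat).
Local Notation V := 'rV[R]_n.
Variables (ip : V -> V -> R) (P : V -> V -> V -> V).
Hypothesis H : rank_one_triple ip P.
Variable s : R.
Hypothesis s2 : s * s = 1.
Implicit Types (x y z v w p q : V).

Local Notation tri := (jtriple ip P).
Local Notation conf := (conf_factor ip s).
Local Notation gform := (gmetric ip P s).
Local Notation ipC := (ipC H).
Local Notation PC := (PC H).

Definition tE := triE H.

Lemma triDm x p q y : tri x (p + q) y = tri x p y + tri x q y.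
Proof. by rewrite /jtriple !tE; apply/rowP => i; rewrite !mxE; ring. Qed.
Lemma triZm (k : R) x p y : tri x (k *: p) y = k *: tri x p y.
Proof. by rewrite /jtriple !tE; apply/rowP => i; rewrite !mxE; ring. Qed.
Lemma triDl x x' p y : tri (x + x') p y = tri x p y + tri x' p y.
Proof. by rewrite /jtriple !tE; apply/rowP => i; rewrite !mxE; ring. Qed.
Lemma triZl (k : R) x p y : tri (k *: x) p y = k *: tri x p y.
Proof. by rewrite /jtriple !tE; apply/rowP => i; rewrite !mxE; ring. Qed.
Lemma triDr x p y y' : tri x p (y + y') = tri x p y + tri x p y'.
Proof. by rewrite !(triC H x) triDl. Qed.
Lemma triZr (k : R) x p y : tri x p (k *: y) = k *: tri x p y.
Proof. by rewrite !(triC H x) triZl. Qed.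

Lemma gformC p x y : gform p x y = gform p y x.
Proof. by rewrite /gmetric (P_adj H) !(ipC x). Qed.
Lemma gformDl p x x' y : gform p (x + x') y = gform p x y + gform p x' y.
Proof. by rewrite /gmetric !tE; ring. Qed.
Lemma gformZl p (k : R) x y : gform p (k *: x) y = k * gform p x y.
Proof. by rewrite /gmetric !tE; ring. Qed.
Lemma gformBl p x x' y : gform p (x - x') y = gform p x y - gform p x' y.
Proof. by rewrite /gmetric !tE; ring. Qed.
Lemma gformDr p x y y' : gform p x (y + y') = gform p x y + gform p x y'.
Proof. by rewrite !(gformC p x) gformDl. Qed.
Lemma gformZr p (k : R) x y : gform p x (k *: y) = k * gform p x y.
Proof. by rewrite !(gformC p x) gformZl. Qed.

(** * First derivatives of the metric and Christoffel symbols *)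

Lemma is_derive_conf p z :
  is_derive (0 : R) (1 : R) (fun t : R => conf (p + t *: z)) (2 * s * ip p z).
Proof.
rewrite (_ : (fun t : R => _) = fun t : R =>
  conf p + (2 * s * ip p z) * t + (s * ip z z) * t ^+ 2 + 0 * t ^+ 3).
  exact: is_derive_cubic.
by apply/funext => t; rewrite /conf_factor !tE (ipC z p); ring.
Qed.

Lemma is_derive_gnum p z x y :
  is_derive (0 : R) (1 : R)
    (fun t : R => ip x y * conf (p + t *: z)
        - s / 2 * ip (P (p + t *: z) (p + t *: z) x) y)
    (2 * s * ip p z * ip x y - s * ip (P p z x) y).
Proof.
rewrite (_ : (fun t : R => _) = fun t : R =>
  (ip x y * conf p - s / 2 * ip (P p p x) y)
  + (2 * s * ip p z * ip x y - s * ip (P p z x) y) * t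
  + (s * ip z z * ip x y - s / 2 * ip (P z z x) y) * t ^+ 2 + 0 * t ^+ 3).
  exact: is_derive_cubic.
by apply/funext => t; rewrite /conf_factor !tE (ipC z p) (PC z p); field.
Qed.

Lemma is_derive_tri p z x y w :
  is_derive (0 : R) (1 : R) (fun t : R => - s * ip (tri x (p + t *: z) y) w)
    (- s * ip (tri x z y) w).
Proof.
rewrite (_ : (fun t : R => _) = fun t : R =>
  - s * ip (tri x p y) w + (- s * ip (tri x z y) w) * t + 0 * t ^+ 2 + 0 * t ^+ 3).
  exact: is_derive_cubic.
by apply/funext => t; rewrite triDm triZm !tE; ring.
Qed.

Lemma is_derive_Ptri p z x y w :
  is_derive (0 : R) (1 : R)
    (fun t : R => 2^-1 * ip (P (p + t *: z) (p + t *: z) (tri x (p + t *: z) y)) w)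
    (ip (P p z (tri x p y)) w + 2^-1 * ip (P p p (tri x z y)) w).
Proof.
set a := tri x p y; set b := tri x z y.
rewrite (_ : (fun t : R => _) = fun t : R =>
  2^-1 * ip (P p p a) w + (ip (P p z a) w + 2^-1 * ip (P p p b) w) * t
  + (2^-1 * ip (P z z a) w + ip (P p z b) w) * t ^+ 2
  + (2^-1 * ip (P z z b) w) * t ^+ 3).
  exact: is_derive_cubic.
by apply/funext => t; rewrite triDm triZm -/a -/b !tE !(PC z p); field.
Qed.

(** The closed formulas need a positive conformal factor; having them near [t = 0] is what allows a
    second differentiation. *)
Lemma conf_near p z : 0 < conf p -> \forall t \near (0 : R), 0 < conf (p + t *: z).
Proof.
move=> D0.
have cts : {for (0 : R), continuous (fun t : R => conf (p + t *: z))}.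
  apply/differentiable_continuous/derivable1_diffP.
  exact: (@ex_derive _ _ _ _ _ _ _ (is_derive_conf p z)).
by apply: (cvgr_gt _ cts); rewrite scale0r addr0.
Qed.

Definition dgform p z x y :=
  - (2 * s * ip p z * ip x y) / conf p ^+ 2
  + 2 * ip p z * ip (P p p x) y / conf p ^+ 3 - s * ip (P p z x) y / conf p ^+ 2.

Lemma is_derive_gform p z x y : 0 < conf p ->
  is_derive (0 : R) (1 : R) (fun t : R => gform (p + t *: z) x y) (dgform p z x y).
Proof.
move=> D0; have c0 : conf p != 0 by rewrite lt0r_neq0.
have h := is_derive_quotients (is_derive_gnum p z x y) (is_derive_cst (0 : R) (0 : R) (1 : R))
  (is_derive_conf p z) _.
rewrite (_ : (fun t : R => _) = fun t : R => (ip x y * conf (p + t *: z)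
   - s / 2 * ip (P (p + t *: z) (p + t *: z) x) y) / conf (p + t *: z) ^+ 2
   + cst 0 t / conf (p + t *: z) ^+ 3); last first.
  by apply/funext => t; rewrite /gmetric /= mul0r addr0.
apply: is_derive_eq (h _) _; rewrite scale0r addr0 //=.
rewrite /dgform.
transitivity (- (2 * s * ip p z * ip x y) / conf p ^+ 2
  + (s * s) * (2 * ip p z * ip (P p p x) y) / conf p ^+ 3 - s * ip (P p z x) y / conf p ^+ 2).
  by field.
by rewrite s2 mul1r.
Qed.

Definition Gam p x y := - (s / conf p) *: tri x p y.

Lemma gform_Gam p x y w : 0 < conf p -> gform p (Gam p x y) w =
  - s * ip (tri x p y) w / conf p ^+ 2
  + 2^-1 * ip (P p p (tri x p y)) w / conf p ^+ 3.
Proof.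
move=> D0; have c0 : conf p != 0 by rewrite lt0r_neq0.
rewrite /Gam gformZl /gmetric.
transitivity (- s * ip (tri x p y) w / conf p ^+ 2
  + (s * s) * 2^-1 * ip (P p p (tri x p y)) w / conf p ^+ 3); first by field.
by rewrite s2 mul1r.
Qed.

Lemma P_absorb p x y : P p p (P x y p) = (2 * ip (P p p x) y) *: p.
Proof.
apply/rowP => i; move/(congr1 (fun y : V => y 0 i)): (P_cliff H p p x y p).
by rewrite !(P_diag H, tE) !mxE; lra.
Qed.

(** The terms over [conf p ^+ 2] agree by the cyclic identity [P_cyc], those over [conf p ^+ 3] by
    [P_absorb]. *)
Lemma koszul p x y w : 0 < conf p ->
  (dgform p x y w + dgform p y x w - dgform p w x y) / 2 = gform p (Gam p x y) w.
Proof.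
move=> D0; have c0 : conf p != 0 by rewrite lt0r_neq0.
rewrite gform_Gam // /jtriple !tE P_absorb !tE.
have e := congr1 (ip^~ w) (P_cyc H p x y); rewrite /= !tE in e.
rewrite /dgform (P_pair H p w x) (PC p y x) (PC x y p).
rewrite (PC x y p) in e; rewrite (ipC y p) in e.
have -> : ip (P y p x) w = 2 * (ip p x * ip y w + ip x y * ip p w + ip p y * ip x w)
  - ip (P p x y) w - ip (P y x p) w by lra.
by field.
Qed.

Lemma gform_compat p z x y : 0 < conf p ->
  dgform p z x y = gform p (Gam p z x) y + gform p x (Gam p z y).
Proof.
move=> D0; rewrite (gformC p x) -!koszul //.
have dC a b c : dgform p a b c = dgform p a c b.
  by rewrite /dgform (P_adj H p p b) (P_adj H p a b) !(ipC b).
by rewrite (dC z y x); field.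
Qed.

(** The derivative of [Gam] at [p] in direction [z]; the conformal factor has derivative
    [2 s <p,z>], and [s^2 = 1] removes the sign. *)
Definition dGam p z x y :=
  (2 * ip p z / conf p ^+ 2) *: tri x p y - (s / conf p) *: tri x z y.

Lemma is_derive_gform_Gam p z x y w : 0 < conf p ->
  is_derive (0 : R) (1 : R)
    (fun t : R => gform (p + t *: z) (Gam (p + t *: z) x y) w)
    (dgform p z (Gam p x y) w + gform p (dGam p z x y) w).
Proof.
move=> D0; have c0 : conf p != 0 by rewrite lt0r_neq0.
have h := is_derive_quotients (is_derive_tri p z x y w) (is_derive_Ptri p z x y w)
  (is_derive_conf p z) _.
apply: near_eq_is_derive.
  near=> t; symmetry; apply: gform_Gam; near: t; exact: conf_near.
apply: is_derive_eq (h _) _; rewrite scale0r addr0 //.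
rewrite /dgform /dGam /Gam -[- (_ *: tri x z y)]scaleNr; move: (tri x p y) (tri x z y) => a b.
by rewrite gformDl !gformZl !tE /gmetric; field: s2.
Unshelve. all: by end_near. Qed.

(** For constant fields this is [R(x,y) = [nabla_y, nabla_x]], the order imposed by the sign
    convention of [Rcov]. *)
Definition Rvec p x y z :=
  dGam p y x z + Gam p y (Gam p x z) - (dGam p x y z + Gam p x (Gam p y z)).

(** By [tri_commutator] the terms with [<p,v>] and [<p,x>] cancel against [dGam], and the rest
    assembles into [gop v] and [gop x]. *)
Lemma Rvec_jac p v x : 0 < conf p -> Rvec p v x v = jac ip P s p v x.
Proof.
move=> D0; have c0 : conf p != 0 by rewrite lt0r_neq0.
have e := tri_commutator H x p v.
rewrite /Rvec /jac /dGam /Gam /gop -[- (_ *: P p p v)]scaleNr -[- (_ *: P p p x)]scaleNr.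
rewrite !(triDm, triZm, triZr) (triC H x (P p p v)) (triC H x v v).
move: e; move: (tri x p (tri v p v)) (tri v p (tri x p v)) => a b.
move: (tri x p v) (tri v p v) (tri v (P p p v) x) (tri v (P p p x) v) (tri v v x) (tri v x v)
  => c d f g h l e.
apply/rowP => i; move/(congr1 (fun y : V => y 0 i)): e; rewrite !mxE => e.
have {e} -> : a 0 i = b 0 i + 2 * ip p v * c 0 i - 2 * ip p x * d 0 i
  - 2^-1 * f 0 i + 2^-1 * g 0 i by lra.
by field: s2.
Qed.

(** * From the invariant formulas to matrices and coordinate tensors *)

Variable ds2 : V -> V -> R.
Hypothesis ds2E : forall q x, ds2 q x = gform q x x.

Lemma gmatE q i j : gmat ds2 q i j = gform q (ev i) (ev j).
Proof.
rewrite mxE !ds2E -[- ev j]scaleN1r !(gformDl, gformDr, gformZl, gformZr).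
by rewrite (gformC q (ev j) (ev i)); field.
Qed.

Lemma mulmx_gmat p x j : (x *m gmat ds2 p) 0 j = gform p x (ev j).
Proof.
rewrite mxE [RHS](@row_linear_sum R n R^o (fun x => gform p x (ev j))).
- by apply: eq_bigr => i _; rewrite gmatE.
- by move=> y z; exact: gformDl.
- by move=> k y; exact: gformZl.
Qed.

Lemma gbilE p x y : gbil ds2 p x y = gform p x y.
Proof.
rewrite /gbil mxE [RHS](@row_linear_sum R n R^o (gform p x)).
- by apply: eq_bigr => i _; rewrite mulmx_gmat mxE mulrC.
- by move=> u z; exact: gformDr.
- by move=> k u; exact: gformZr.
Qed.

Lemma gmat_unit p : 0 < conf p -> gmat ds2 p \in unitmx.
Proof.
move=> D0; rewrite -row_free_unit; apply: inj_row_free => x e.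
have e0 y : gform p x y = 0.
  by rewrite -gbilE /gbil e mul0mx mxE.
rewrite -(gopK H D0 x) (_ : gop _ _ _ _ _ = 0).
  by rewrite /gop_inv -(scale0r 0) (PZr H) !scale0r !scaler0 addr0 scaler0.
by apply: (ip_nondeg H) => y; rewrite -(gformE H).
Qed.

(** Raises an index without computing the inverse matrix. *)
Lemma gmat_solve p (c : 'I_n -> R) y : 0 < conf p ->
  (forall j, c j = gform p y (ev j)) ->
  forall m, \sum_(t < n) invmx (gmat ds2 p) m t * c t = y 0 m.
Proof.
move=> D0 ce m.
have symg : (gmat ds2 p)^T = gmat ds2 p.
  by apply/matrixP => i j; rewrite mxE !gmatE gformC.
have e : invmx (gmat ds2 p) *m (y *m gmat ds2 p)^T = y^T.
  by rewrite trmx_mul symg mulKmx // gmat_unit.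
move/matrixP/(_ m 0): e; rewrite !mxE => <-.
by apply: eq_bigr => t _; rewrite [X in _ = _ * X]mxE mulmx_gmat ce.
Qed.

Lemma dgE p k i j : 0 < conf p -> dg ds2 p k i j = dgform p (ev k) (ev i) (ev j).
Proof.
move=> D0; apply: partialE.
rewrite (_ : (fun t : R => _) = fun t : R => gform (p + t *: ev k) (ev i) (ev j)).
  exact: is_derive_gform.
by apply/funext => t; rewrite gmatE.
Qed.

Lemma Gam1E p k i j : 0 < conf p ->
  Gam1 ds2 p k i j = gform p (Gam p (ev i) (ev j)) (ev k).
Proof. by move=> D0; rewrite /Gam1 !dgE // koszul. Qed.

Lemma partial_Gam1 p k i j l : 0 < conf p ->
  partial (fun q => Gam1 ds2 q k i j) p l
  = dgform p (ev l) (Gam p (ev i) (ev j)) (ev k)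
    + gform p (dGam p (ev l) (ev i) (ev j)) (ev k).
Proof.
move=> D0; apply: partialE; apply: near_eq_is_derive (is_derive_gform_Gam _ _ _ _ D0).
near=> t; symmetry; apply: Gam1E; near: t; exact: conf_near.
Unshelve. all: by end_near. Qed.

(** Metric compatibility splits each derivative of the metric in two; one half builds [Gam] of
    [Gam], the other cancels the double sum with the inverse metric. *)
Lemma RcovE p a b c d : 0 < conf p ->
  Rcov ds2 p a b c d = gform p (Rvec p (ev a) (ev b) (ev c)) (ev d).
Proof.
move=> D0; rewrite /Rcov !partial_Gam1 //.
have sumE i j k l : \sum_(r < n) \sum_(t < n) invmx (gmat ds2 p) r t *
    (Gam1 ds2 p r i j * Gam1 ds2 p t k l)
    = gform p (Gam p (ev i) (ev j)) (Gam p (ev k) (ev l)).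
  rewrite [RHS](@row_linear_sum R n R^o (gform p _)); first last.
  - by move=> q u; exact: gformZr.
  - by move=> u z; exact: gformDr.
  apply: eq_bigr => r _; rewrite -(gmat_solve D0 (fun t => Gam1E t k l D0) r).
  by rewrite /GRing.scale /= mulr_suml; apply: eq_bigr => t _; rewrite Gam1E //; ring.
under eq_bigr do under eq_bigr do rewrite mulrBr.
under eq_bigr do rewrite sumrB.
rewrite sumrB !sumE !(gform_compat _ _ _ D0) /Rvec.
rewrite [RHS]gformBl !(gformDl p (dGam _ _ _ _) (Gam _ _ _)).
by ring.
Qed.

Lemma GamDl p x x' y : Gam p (x + x') y = Gam p x y + Gam p x' y.
Proof. by rewrite /Gam triDl scalerDr. Qed.
Lemma GamZl p (k : R) x y : Gam p (k *: x) y = k *: Gam p x y.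
Proof. by rewrite /Gam triZl !scalerA mulrC. Qed.
Lemma GamDr p x y y' : Gam p x (y + y') = Gam p x y + Gam p x y'.
Proof. by rewrite /Gam triDr scalerDr. Qed.
Lemma GamZr p (k : R) x y : Gam p x (k *: y) = k *: Gam p x y.
Proof. by rewrite /Gam triZr !scalerA mulrC. Qed.

Lemma Rvec_lin1 p y z : {morph (fun x => Rvec p x y z) : x x' / x + x'} /\
  (forall k, {morph (fun x => Rvec p x y z) : x / k *: x}).
Proof.
by split=> [x x'|k x]; rewrite /Rvec /dGam !(GamDl, GamZl, GamDr, GamZr,
  triDl, triZl, triDm, triZm, triDr, triZr) ?tE; apply/rowP => i; rewrite !mxE; ring.
Qed.

Lemma Rvec_lin2 p x z : {morph (fun y => Rvec p x y z) : y y' / y + y'} /\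
  (forall k, {morph (fun y => Rvec p x y z) : y / k *: y}).
Proof.
by split=> [y y'|k y]; rewrite /Rvec /dGam !(GamDl, GamZl, GamDr, GamZr,
  triDl, triZl, triDm, triZm, triDr, triZr) ?tE; apply/rowP => i; rewrite !mxE; ring.
Qed.

Lemma Rvec_lin3 p x y : {morph (fun z => Rvec p x y z) : z z' / z + z'} /\
  (forall k, {morph (fun z => Rvec p x y z) : z / k *: z}).
Proof.
by split=> [z z'|k z]; rewrite /Rvec /dGam !(GamDl, GamZl, GamDr, GamZr,
  triDl, triZl, triDm, triZm, triDr, triZr) ?tE; apply/rowP => i; rewrite !mxE; ring.
Qed.

Lemma curvE p x y z : 0 < conf p -> curv ds2 p x y z = Rvec p x y z.
Proof.
move=> D0; apply/rowP => m; rewrite mxE; apply: gmat_solve => // d.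
have lin (f : V -> V) : {morph f : u u' / u + u'} -> (forall k : R, {morph f : u / k *: u}) ->
    forall u, gform p (f u) (ev d) = \sum_i u 0 i * gform p (f (ev i)) (ev d).
  move=> fD fZ u.
  apply: (@row_linear_sum R n R^o (fun u => gform p (f u) (ev d))) => [u1 u2|k u1].
    by rewrite fD gformDl.
  by rewrite fZ gformZl.
rewrite (lin _ (Rvec_lin1 p y z).1 (Rvec_lin1 p y z).2).
apply: eq_bigr => a _; rewrite (lin _ (Rvec_lin2 p (ev a) z).1 (Rvec_lin2 p (ev a) z).2).
rewrite mulr_sumr; apply: eq_bigr => b _.
rewrite (lin _ (Rvec_lin3 p (ev a) (ev b)).1 (Rvec_lin3 p (ev a) (ev b)).2).
rewrite !mulr_sumr; apply: eq_bigr => c _.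
by rewrite RcovE // !mulrA.
Qed.

Lemma special_osserman_rank_one p : 0 < conf p ->
  (forall v, ip v v != 0 -> exists x, P v v x != (2 * ip v v) *: x) ->
  (forall v, ip v v != 0 -> exists x, P v v x != (2 * ip v x) *: v) ->
  special_osserman_at ds2 p (4 * s) s.
Proof.
move=> D0 N1 N2; apply: special_osserman_atE.
apply: (@osserman_transport R n (gsqrt ip P s p) _ ip _ (jac0 ip P s)).
- by move=> x y; rewrite /gsqrt !tE; apply/rowP => i; rewrite !mxE; ring.
- by move=> k x; rewrite /gsqrt !tE; apply/rowP => i; rewrite !mxE; ring.
- exact: gsqrt_inj.
- exact: gsqrt_surj.
- by move=> x y; rewrite gbilE gform_sqrt.
- by move=> v x; rewrite /jacobi curvE // Rvec_jac // gsqrt_jac.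
- exact: jac0_osserman.
Qed.

End Curvature.

(** * Octonions and para-octonions *)

Section CayleyDickson.
Variables (R : realType) (s : R).
Implicit Types (a b c x y : kel R).

Definition kplus a b : kel R := (qadd a.1 b.1, qadd a.2 b.2).
Definition kscale (k : R) a : kel R := (qscale k a.1, qscale k a.2).
Definition kip a b : R := kre (kmul s a (kconj b)).

Ltac kring := repeat match goal with x : kel R |- _ => destruct x as [[? ? ? ?] [? ? ? ?]] end;
  cbv [kip kre knorm2 kmul kconj kplus kscale qadd qmul qscale qconj qopp qa qb qc qd fst snd];
  first [ring | congr (Quat _ _ _ _, Quat _ _ _ _); ring].

Lemma knorm2E a : knorm2 s a = kip a a.
Proof. by []. Qed.
Lemma kipC a b : kip a b = kip b a.
Proof. by kring. Qed.
Lemma kipDl a b c : kip (kplus a b) c = kip a c + kip b c.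
Proof. by kring. Qed.
Lemma kipZl k a c : kip (kscale k a) c = k * kip a c.
Proof. by kring. Qed.
Lemma kconjD a b : kconj (kplus a b) = kplus (kconj a) (kconj b).
Proof. by kring. Qed.
Lemma kconjK a : kconj (kconj a) = a.
Proof. by kring. Qed.
Lemma kconjM a b : kconj (kmul s a b) = kmul s (kconj b) (kconj a).
Proof. by kring. Qed.

Lemma kmul_ip a b c : kip (kmul s a b) c = kip a (kmul s c (kconj b)).
Proof. by kring. Qed.
Lemma kip_conj a b : kip (kconj a) (kconj b) = kip a b.
Proof. by kring. Qed.

(** First row of the Clifford relation for the Hermitian matrices with diagonals [k, l] and [k', l']
    and corners [a], [b]. Its octonionic content is the polarised alternative law
    [a (conj b x) + b (conj a x) = 2 <a,b> x]. *)
Lemma kblock_cliff (k l k' l' : R) a b x y :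
  kplus (kplus (kscale k (kplus (kscale k' x) (kmul s b y)))
             (kmul s a (kplus (kmul s (kconj b) x) (kscale l' y))))
       (kplus (kscale k' (kplus (kscale k x) (kmul s a y)))
             (kmul s b (kplus (kmul s (kconj a) x) (kscale l y))))
  = kplus (kplus (kscale (k' + l') (kplus (kscale k x) (kmul s a y)))
               (kscale (k + l) (kplus (kscale k' x) (kmul s b y))))
         (kscale (k * k' + l * l' + 2 * kip a b - (k + l) * (k' + l')) x).
Proof. by kring. Qed.

(** Full polarisation of the alternative law [(x1 conj x2) x2 = <x2,x2> x1], which is the first
    component of [P x x x = 2 <x,x> x]. *)
Lemma krank_one a1 a2 b1 b2 c1 c2 :
  kplus (kplus
    (kplus (kscale (2 * kip a1 b1) c1)
          (kmul s (kplus (kmul s a1 (kconj b2)) (kmul s b1 (kconj a2))) c2))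
    (kplus (kscale (2 * kip b1 c1) a1)
          (kmul s (kplus (kmul s b1 (kconj c2)) (kmul s c1 (kconj b2))) a2)))
    (kplus (kscale (2 * kip c1 a1) b1)
          (kmul s (kplus (kmul s c1 (kconj a2)) (kmul s a1 (kconj c2))) b2))
  = kscale 2 (kplus (kplus (kscale (kip a1 b1 + kip a2 b2) c1)
       (kscale (kip b1 c1 + kip b2 c2) a1)) (kscale (kip c1 a1 + kip c2 a2) b1)).
Proof. by kring. Qed.

(** The off-diagonal entry of the Hermitian matrix attached to [x] and [y]. *)
Definition kcross x1 x2 y1 y2 : kel R :=
  kplus (kmul s x1 (kconj y2)) (kmul s y1 (kconj x2)).
(* The first component of P(x,y)z on K^2; the second one is obtained by exchanging the
   two components of every argument. *)
Definition khalf x1 x2 y1 y2 z1 z2 : kel R :=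
  kplus (kscale (2 * kip x1 y1) z1) (kmul s (kcross x1 x2 y1 y2) z2).

Ltac khring := cbv [khalf kcross]; kring.

Lemma khalfDl x1 x2 x1' x2' y1 y2 z1 z2 :
  khalf (kplus x1 x1') (kplus x2 x2') y1 y2 z1 z2
  = kplus (khalf x1 x2 y1 y2 z1 z2) (khalf x1' x2' y1 y2 z1 z2).
Proof. by khring. Qed.
Lemma khalfZl k x1 x2 y1 y2 z1 z2 :
  khalf (kscale k x1) (kscale k x2) y1 y2 z1 z2 = kscale k (khalf x1 x2 y1 y2 z1 z2).
Proof. by khring. Qed.
Lemma khalfDr x1 x2 y1 y2 z1 z2 z1' z2' :
  khalf x1 x2 y1 y2 (kplus z1 z1') (kplus z2 z2')
  = kplus (khalf x1 x2 y1 y2 z1 z2) (khalf x1 x2 y1 y2 z1' z2').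
Proof. by khring. Qed.
Lemma khalfZr k x1 x2 y1 y2 z1 z2 :
  khalf x1 x2 y1 y2 (kscale k z1) (kscale k z2) = kscale k (khalf x1 x2 y1 y2 z1 z2).
Proof. by khring. Qed.

Lemma kplusC a b : kplus a b = kplus b a.
Proof. by rewrite /kplus /qadd !(addrC (_ a.1)) !(addrC (_ a.2)). Qed.
Lemma kcross_conj x1 x2 y1 y2 : kconj (kcross x1 x2 y1 y2) = kcross x2 x1 y2 y1.
Proof. by rewrite /kcross kconjD !kconjM !kconjK kplusC. Qed.

(** The right-hand side is symmetric in the pairs (x,y) and (z,w), whence [P_pair]; it also gives
    the scalar term of [khalf_cliff]. *)
Lemma kip_khalf x1 x2 y1 y2 z1 z2 w1 w2 :
  kip (khalf x1 x2 y1 y2 z1 z2) w1 + kip (khalf x2 x1 y2 y1 z2 z1) w2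
  = 2 * kip x1 y1 * kip z1 w1 + 2 * kip x2 y2 * kip z2 w2
    + kip (kcross x1 x2 y1 y2) (kcross z1 z2 w1 w2).
Proof.
rewrite /khalf -(kcross_conj x1); move: (kcross x1 x2 y1 y2) => c.
have e : kip (kmul s (kconj c) z1) w2 = kip c (kmul s z1 (kconj w2)).
  by rewrite kmul_ip -kip_conj kconjM !kconjK.
rewrite !kipDl !kipZl e kmul_ip.
by rewrite /kcross (kipC c (kplus _ _)) kipDl !(kipC _ c); ring.
Qed.

Lemma khalf_cyc x1 x2 y1 y2 z1 z2 :
  kplus (kplus (khalf x1 x2 y1 y2 z1 z2) (khalf y1 y2 z1 z2 x1 x2)) (khalf z1 z2 x1 x2 y1 y2)
  = kscale 2 (kplus (kplus (kscale (kip x1 y1 + kip x2 y2) z1)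
       (kscale (kip y1 z1 + kip y2 z2) x1)) (kscale (kip z1 x1 + kip z2 x2) y1)).
Proof. exact: krank_one. Qed.

(** The version met in the second component, where the summands of the inner product come in the
    opposite order. *)
Lemma khalf_cyc_swap x1 x2 y1 y2 z1 z2 :
  kplus (kplus (khalf x1 x2 y1 y2 z1 z2) (khalf y1 y2 z1 z2 x1 x2)) (khalf z1 z2 x1 x2 y1 y2)
  = kscale 2 (kplus (kplus (kscale (kip x2 y2 + kip x1 y1) z1)
       (kscale (kip y2 z2 + kip y1 z1) x1)) (kscale (kip z2 x2 + kip z1 x1) y1)).
Proof.
rewrite khalf_cyc (addrC (kip x1 y1) (kip x2 y2)) (addrC (kip y1 z1) (kip y2 z2)).
by rewrite (addrC (kip z1 x1) (kip z2 x2)).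
Qed.

Lemma khalfC x1 x2 y1 y2 z1 z2 : khalf x1 x2 y1 y2 z1 z2 = khalf y1 y2 x1 x2 z1 z2.
Proof.
rewrite /khalf (kipC x1 y1) /kcross.
by rewrite (kplusC (kmul s x1 (kconj y2)) (kmul s y1 (kconj x2))).
Qed.

Lemma khalf_cliff x1 x2 y1 y2 z1 z2 w1 w2 t1 t2 :
  kplus (khalf x1 x2 y1 y2 (khalf z1 z2 w1 w2 t1 t2) (khalf z2 z1 w2 w1 t2 t1))
       (khalf z1 z2 w1 w2 (khalf x1 x2 y1 y2 t1 t2) (khalf x2 x1 y2 y1 t2 t1))
  = kplus (kplus (kscale (2 * (kip z1 w1 + kip z2 w2)) (khalf x1 x2 y1 y2 t1 t2))
               (kscale (2 * (kip x1 y1 + kip x2 y2)) (khalf z1 z2 w1 w2 t1 t2)))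
         (kscale (2 * (kip (khalf x1 x2 y1 y2 z1 z2) w1 + kip (khalf x2 x1 y2 y1 z2 z1) w2)
           - 4 * (kip x1 y1 + kip x2 y2) * (kip z1 w1 + kip z2 w2)) t1).
Proof.
rewrite kip_khalf /khalf -(kcross_conj x1) -(kcross_conj z1).
move: (kcross x1 x2 y1 y2) (kcross z1 z2 w1 w2) => a b.
have := kblock_cliff (2 * kip x1 y1) (2 * kip x2 y2) (2 * kip z1 w1) (2 * kip z2 w2) a b t1 t2.
rewrite !(kplusC (kmul s (kconj _) _)) => ->.
by congr (kplus (kplus (kscale _ _) (kscale _ _)) (kscale _ _)); ring.
Qed.

Lemma khalf_cliff_swap x1 x2 y1 y2 z1 z2 w1 w2 t1 t2 :
  kplus (khalf x1 x2 y1 y2 (khalf z1 z2 w1 w2 t1 t2) (khalf z2 z1 w2 w1 t2 t1))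
       (khalf z1 z2 w1 w2 (khalf x1 x2 y1 y2 t1 t2) (khalf x2 x1 y2 y1 t2 t1))
  = kplus (kplus (kscale (2 * (kip z2 w2 + kip z1 w1)) (khalf x1 x2 y1 y2 t1 t2))
               (kscale (2 * (kip x2 y2 + kip x1 y1)) (khalf z1 z2 w1 w2 t1 t2)))
         (kscale (2 * (kip (khalf x2 x1 y2 y1 z2 z1) w2 + kip (khalf x1 x2 y1 y2 z1 z2) w1)
           - 4 * (kip x2 y2 + kip x1 y1) * (kip z2 w2 + kip z1 w1)) t1).
Proof.
rewrite khalf_cliff (addrC (kip x1 y1) (kip x2 y2)) (addrC (kip z1 w1) (kip z2 w2)).
by rewrite (addrC (kip (khalf x1 x2 y1 y2 z1 z2) w1) (kip (khalf x2 x1 y2 y1 z2 z1) w2)).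
Qed.

Definition kzero : kel R := (Quat 0 0 0 0, Quat 0 0 0 0).
Definition kone : kel R := (Quat 1 0 0 0, Quat 0 0 0 0).
Definition kI : kel R := (Quat 0 1 0 0, Quat 0 0 0 0).

Lemma kip0 a : kip a kzero = 0.
Proof. by rewrite /kip /kre /kmul /=; ring. Qed.
Lemma kip1 a : kip a kone = qa a.1.
Proof. by rewrite /kip /kre /kmul /=; ring. Qed.
Lemma kipI a : kip a kI = qb a.1.
Proof. by rewrite /kip /kre /kmul /=; ring. Qed.

Lemma khalf0 x1 x2 y1 y2 z1 : khalf x1 x2 y1 y2 z1 kzero = kscale (2 * kip x1 y1) z1.
Proof.
rewrite /khalf; move: (kcross x1 x2 y1 y2) (kscale _ z1) => c [[b0 b1 b2 b3] [b4 b5 b6 b7]].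
rewrite /kmul /kplus /qadd /qmul /qscale /qconj /=.
by congr (Quat _ _ _ _, Quat _ _ _ _); ring.
Qed.

End CayleyDickson.

(** * The plane K^2 in real coordinates as a rank one triple *)

Section Plane.
Variables (R : realType) (s : R).
Local Notation V := 'rV[R]_16.

Definition rowk (a b : kel R) : V := \row_(i < 16) nth 0
  [:: qa a.1; qb a.1; qc a.1; qd a.1; qa a.2; qb a.2; qc a.2; qd a.2;
      qa b.1; qb b.1; qc b.1; qd b.1; qa b.2; qb b.2; qc b.2; qd b.2] i.

Lemma cu_rowk a b : cu (rowk a b) = a.
Proof.
by case: a => [[? ? ? ?] [? ? ? ?]]; rewrite /cu /kel_at /rc !mxE !inordK.
Qed.
Lemma cv_rowk a b : cv (rowk a b) = b.
Proof.
by case: b => [[? ? ? ?] [? ? ? ?]]; rewrite /cv /kel_at /rc !mxE !inordK.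
Qed.

Lemma row_kel_inj (x y : V) : cu x = cu y -> cv x = cv y -> x = y.
Proof.
move=> [] e0 e1 e2 e3 e4 e5 e6 e7 [] e8 e9 e10 e11 e12 e13 e14 e15.
have rcE (z : V) (i : 'I_16) : z 0 i = rc z i by rewrite /rc inord_val.
apply/rowP => i; rewrite !rcE; case: i => m /= lt.
by do 16 (case: m lt => [_ //|m lt]).
Qed.

Lemma cuD x y : cu (x + y : V) = kplus (cu x) (cu y).
Proof. by rewrite /cu /kel_at /rc !mxE. Qed.
Lemma cvD x y : cv (x + y : V) = kplus (cv x) (cv y).
Proof. by rewrite /cv /kel_at /rc !mxE. Qed.
Lemma cuZ k x : cu (k *: x : V) = kscale k (cu x).
Proof. by rewrite /cu /kel_at /rc !mxE. Qed.
Lemma cvZ k x : cv (k *: x : V) = kscale k (cv x).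
Proof. by rewrite /cv /kel_at /rc !mxE. Qed.

Definition kplane_ip (x y : V) : R := kip s (cu x) (cu y) + kip s (cv x) (cv y).
Definition kplane_P (x y z : V) : V :=
  rowk (khalf s (cu x) (cv x) (cu y) (cv y) (cu z) (cv z))
       (khalf s (cv x) (cu x) (cv y) (cu y) (cv z) (cu z)).

Definition cE := (cu_rowk, cv_rowk, cuD, cvD, cuZ, cvZ).

Hypothesis s2 : s * s = 1.

Lemma kip_nondeg (a : kel R) : (forall b, kip s a b = 0) ->
  a = (Quat 0 0 0 0, Quat 0 0 0 0).
Proof.
case: a => [[a0 a1 a2 a3] [a4 a5 a6 a7]] h.
(* The second quaternion enters the form with the factor [-s], which must be cancelled. *)
have k0 t : s * t = 0 -> t = 0.
  by move=> e; rewrite -(mul1r t) -s2 -mulrA e mulr0.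
have e0 := h (Quat 1 0 0 0, Quat 0 0 0 0); have e1 := h (Quat 0 1 0 0, Quat 0 0 0 0).
have e2 := h (Quat 0 0 1 0, Quat 0 0 0 0); have e3 := h (Quat 0 0 0 1, Quat 0 0 0 0).
have e4 := h (Quat 0 0 0 0, Quat 1 0 0 0); have e5 := h (Quat 0 0 0 0, Quat 0 1 0 0).
have e6 := h (Quat 0 0 0 0, Quat 0 0 1 0); have e7 := h (Quat 0 0 0 0, Quat 0 0 0 1).
rewrite /kip /kre /kmul /= in e0 e1 e2 e3 e4 e5 e6 e7.
congr (Quat _ _ _ _, Quat _ _ _ _); first [lra | apply: k0; lra].
Qed.

Lemma kplane_rank_one : rank_one_triple kplane_ip kplane_P.
Proof.
split.
- by move=> x y; rewrite /kplane_ip (kipC _ (cu x)) (kipC _ (cv x)).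
- by move=> x y z; rewrite /kplane_ip !cE !kipDl addrACA.
- by move=> k x z; rewrite /kplane_ip !cE !kipZl [RHS]mulrDr.
- move=> x h; apply: row_kel_inj.
    rewrite [RHS]/cu /kel_at /rc !mxE; apply: kip_nondeg => b.
    have := h (rowk b (Quat 0 0 0 0, Quat 0 0 0 0)).
    rewrite /kplane_ip !cE [X in _ + X](_ : _ = 0) ?addr0 //.
    by rewrite /kip /kre /kmul /=; ring.
  rewrite [RHS]/cv /kel_at /rc !mxE; apply: kip_nondeg => b.
  have := h (rowk (Quat 0 0 0 0, Quat 0 0 0 0) b).
  rewrite /kplane_ip !cE [X in X + _](_ : _ = 0) ?add0r //.
  by rewrite /kip /kre /kmul /=; ring.
- by move=> x y z; rewrite /kplane_P (khalfC _ (cu x)) (khalfC _ (cv x)).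
- by move=> x x' y z; apply: row_kel_inj; rewrite !cE khalfDl.
- by move=> k x y z; apply: row_kel_inj; rewrite !cE khalfZl.
- by move=> x y z z'; apply: row_kel_inj; rewrite !cE khalfDr.
- by move=> k x y z; apply: row_kel_inj; rewrite !cE khalfZr.
- move=> x y z w; rewrite /kplane_ip !cE !kip_khalf.
  by rewrite [kip s (kcross _ _ _ _ _) _]kipC; ring.
- move=> x y z; apply: row_kel_inj; rewrite /kplane_ip !cE.
    exact: khalf_cyc.
  exact: khalf_cyc_swap.
- move=> x y z w t; apply: row_kel_inj; rewrite /kplane_ip !cE.
    exact: khalf_cliff.
  exact: khalf_cliff_swap.
Qed.

Lemma kplane_not_scalar (v : V) : kplane_ip v v != 0 ->
  exists x, kplane_P v v x != (2 * kplane_ip v v) *: x.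
Proof.
move=> vn0; apply: contrapT => h.
have {}h x : kplane_P v v x = (2 * kplane_ip v v) *: x.
  by apply/eqP; apply: contrapT => /negP nx; apply: h; exists x.
(* Testing on (1,0) and (0,1) gives [a = a + b] and [b = a + b] for the norms [a], [b] of the
   components of [v], so both vanish. *)
have e1 := congr1 cu (h (rowk (kone R) (kzero R))).
have e2 := congr1 cv (h (rowk (kzero R) (kone R))).
rewrite !cE !khalf0 in e1 e2; move/(congr1 (fun a => qa a.1)): e1 => /= e1.
move/(congr1 (fun a => qa a.1)): e2 => /= e2.
case/eqP: vn0; move: e1 e2; rewrite /kplane_ip.
move: (kip _ (cu v) _) (kip _ (cv v) _) => a b; lra.
Qed.

Lemma kplane_not_rank_one (v : V) : kplane_ip v v != 0 ->
  exists x, kplane_P v v x != (2 * kplane_ip v x) *: v.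
Proof.
move=> vn0; apply: contrapT => h.
have {}h x : kplane_P v v x = (2 * kplane_ip v x) *: v.
  by apply/eqP; apply: contrapT => /negP nx; apply: h; exists x.
(* A scalar map of K cannot have real rank one unless it is zero: testing on 1 and i gives
   [d = x^2 = y^2] and [x y = 0]. *)
have key (a : kel R) (f : kel R -> R) (d : R) : f (kone R) = qa a.1 -> f (kI R) = qb a.1 ->
    (forall e, kscale (2 * d) e = kscale (2 * f e) a) -> d = 0.
  move=> f1 fI he; have e1 := he (kone R); have e2 := he (kI R); rewrite f1 in e1.
  rewrite fI in e2; have := congr1 (fun a => qb a.1) e2; have := congr1 (fun a => qb a.1) e1.
  have := congr1 (fun a => qa a.1) e1; rewrite /=; move: (qa _) (qb _) => x y h1 h2 h3.
  have {}h1 : d = x * x by lra.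
  have {}h2 : x * y = 0 by lra.
  have {}h3 : d = y * y by lra.
  have : d * d = 0 by rewrite {1}h1 h3 mulrACA h2 mul0r.
  by move/eqP; rewrite mulf_eq0 orbb => /eqP.
have cl (e : kel R) : kscale (2 * kip s (cu v) (cu v)) e = kscale (2 * kip s (cu v) e) (cu v).
  have := congr1 cu (h (rowk e (kzero R))).
  by rewrite /kplane_P /kplane_ip !cE khalf0 kip0 addr0.
have cr (e : kel R) : kscale (2 * kip s (cv v) (cv v)) e = kscale (2 * kip s (cv v) e) (cv v).
  have := congr1 cv (h (rowk (kzero R) e)).
  by rewrite /kplane_P /kplane_ip !cE khalf0 kip0 add0r.
case/eqP: vn0; rewrite /kplane_ip (key _ _ _ (kip1 s (cu v)) (kipI s (cu v)) cl).
by rewrite (key _ _ _ (kip1 s (cv v)) (kipI s (cv v)) cr) addr0.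
Qed.

End Plane.

(** * Identification of the three metrics *)

Lemma kplane_P_diag (R : realType) (s : R) (p x : 'rV[R]_16) :
  kplane_ip s (kplane_P s p p x) x
  = 2 * kip s (cu p) (cu p) * kip s (cu x) (cu x)
    + 2 * kip s (cv p) (cv p) * kip s (cv x) (cv x)
    + 4 * kre (kmul s (kmul s (cu p) (kconj (cv p))) (kmul s (cv x) (kconj (cu x)))).
Proof.
(* This turns the cross term of [ds^2] into the inner product of [u conj v] with [xi conj eta]. *)
have -> : kmul s (cv x) (kconj (cu x)) = kconj (kmul s (cu x) (kconj (cv x))).
  by rewrite kconjM kconjK.
rewrite -/(kip s _ _) {1}/kplane_ip !cE kip_khalf /kcross.
move: (kmul s (cu p) _) (kmul s (cu x) _) => a b.
by rewrite kipDl (kipC s a) kipDl (kipC s b); ring.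
Qed.

Lemma KP2_ds2E (R : realType) (s : R) (q x : 'rV[R]_16) :
  KP2_ds2 s q x = gmetric (kplane_ip s) (kplane_P s) 1 q x x.
Proof.
rewrite /gmetric kplane_P_diag /KP2_ds2 /conf_factor /kplane_ip !knorm2E.
by congr (_ / (_ ^+ 2)); [field | ring].
Qed.

Lemma OH2_ds2E (R : realType) (q x : 'rV[R]_16) :
  OH2_ds2 q x = gmetric (kplane_ip sO) (kplane_P sO) (-1) q x x.
Proof.
rewrite /gmetric kplane_P_diag /OH2_ds2 /conf_factor /kplane_ip !knorm2E.
by congr (_ / (_ ^+ 2)); [field | ring].
Qed.

(* OP^2 and O'P^2: the three standard charts all have image
   {(u,v) : 1+|u|^2+|v|^2 > 0} and the same coordinate metric, so one
   statement covers every chart; OH^2 is a single chart. *)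
Theorem theorem9p2 (R : realType) :
  [/\ special_osserman (KP2_chart (@sO R)) (KP2_ds2 (@sO R)),
      special_osserman (KP2_chart (@sO' R)) (KP2_ds2 (@sO' R)) &
      special_osserman (@OH2_dom R) (@OH2_ds2 R)].
Proof.
have sO2 : sO * sO = 1 :> R by rewrite /sO mulrNN mulr1.
have sO'2 : sO' * sO' = 1 :> R by rewrite /sO' mulr1.
have tau2 : -1 * -1 = 1 :> R by rewrite mulrNN mulr1.
have KP2 (s : R) : s * s = 1 -> special_osserman (KP2_chart s) (KP2_ds2 s).
  (* Here [s] is the Cayley-Dickson sign; the curvature sign is 1 for both projective planes. *)
  move=> s2; exists (4 * 1), 1; split; [lra..|] => p Dp.
  apply: (special_osserman_rank_one (kplane_rank_one s2) (mulr1 1) (KP2_ds2E s)).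
  - by rewrite /conf_factor mul1r /kplane_ip addrA.
  - exact: kplane_not_scalar.
  - exact: kplane_not_rank_one.
split; [exact: KP2 | exact: KP2 | ].
(* Octonions again, but with curvature sign -1. *)
exists (4 * -1), (-1); split; [lra..|] => p Dp.
apply: (special_osserman_rank_one (kplane_rank_one sO2) tau2 (@OH2_ds2E R)).
- by rewrite /conf_factor mulN1r subr_gt0.
- exact: kplane_not_scalar.
- exact: kplane_not_rank_one.
Qed.
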